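(* Let $K/k$ be a separable field extension of degree $6$ and let $\widetilde{K}/k$ be its Galois closure. Assume that $\operatorname{Gal}(\widetilde{K}/k)\simeq A_6$ and let $F$ be a field with $K\subseteq F\subsetneq\widetilde{K}$. Then $F/k$ is not Hopf Galois.
   Context: A finite extension of fields $L/k$ is called Hopf Galois if there exists a finite cocommutative $k$-Hopf algebra $H$ such that $L$ is an $H$-module algebra and the $k$-linear map $j: L\otimes_k H\to \operatorname{End}_k(L)$, $j(s\otimes h)(t)=s(ht)$ for $h\in H$, $s,t\in L$, is bijective. *)

(* Defs.v *)
From HB Require Import structures.
From mathcomp Require Import all_boot all_order all_algebra.
From mathcomp Require Import all_fingroup all_solvable all_field.

Set Implicit Arguments.
Unset Strict Implicit.
Unset Printing Implicit Defensive.

Import GRing.Theory.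
Local Open Scope ring_scope.

(* Concrete model of V (x) W for finite dimensional V and W: the matrix t stands
   for \sum_(i, j) t i j *: (e_i (x) e'_j), with e and e' the chosen bases of V
   and W.  The universal property is tlift_tens and tensor_ext below. *)
Definition tensor (k : fieldType) (V W : vectType k) : Type :=
  'M[k]_(\dim {:V}, \dim {:W}).

HB.instance Definition _ (k : fieldType) (V W : vectType k) :=
  Vector.copy (tensor V W) 'M[k]_(\dim {:V}, \dim {:W}).

Section Tensor.
Variable k : fieldType.
Implicit Types U V W : vectType k.

Definition tens V W (v : V) (w : W) : tensor V W :=
  \matrix_(i, j) (coord (vbasis {:V}) i v * coord (vbasis {:W}) j w).

(* The linear map out of V (x) W induced by a map f, meant to be bilinear. *)
Definition tlift V W U (f : V -> W -> U) (t : tensor V W) : U :=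
  \sum_i \sum_j (t : 'M_(_, _)) i j *: f (vbasis {:V})`_i (vbasis {:W})`_j.

Fact tlift_is_linear V W U (f : V -> W -> U) : linear (tlift f).
Proof.
move=> a s t; rewrite /tlift scaler_sumr -big_split /=; apply: eq_bigr => i _.
rewrite scaler_sumr -big_split /=; apply: eq_bigr => j _.
by rewrite !mxE scalerDl scalerA.
Qed.

HB.instance Definition _ V W U (f : V -> W -> U) :=
  GRing.isLinear.Build k (tensor V W) U _ (tlift f) (tlift_is_linear f).

Lemma tlift_tens V W U (f : V -> W -> U) :
  (forall v, linear (f v)) -> (forall w, linear (f^~ w)) ->
  forall v w, tlift f (tens v w) = f v w.
Proof.
move=> lfr lfl v w.
pose Fl w' := GRing.isLinear.Build k V U _ (f^~ w') (lfl w').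
pose fl w' : {linear V -> U} := HB.pack (f^~ w') (Fl w').
pose Fr v' := GRing.isLinear.Build k W U _ (f v') (lfr v').
pose fr v' : {linear W -> U} := HB.pack (f v') (Fr v').
rewrite -[RHS]/(fl w v) {2}(coord_vbasis (memvf v)) linear_sum.
apply: eq_bigr => i _.
rewrite linearZ /= -[f _ w]/(fr (vbasis {:V})`_i w).
rewrite {2}(coord_vbasis (memvf w)) linear_sum scaler_sumr.
by apply: eq_bigr => j _; rewrite linearZ /= scalerA mxE.
Qed.

Lemma tensor_ext V W U (f g : {linear tensor V W -> U}) :
  (forall v w, f (tens v w) = g (tens v w)) -> f =1 g.
Proof.
move=> fg t; rewrite (matrix_sum_delta (t : 'M_(_, _))) !linear_sum.
apply: eq_bigr => i _; rewrite !linear_sum; apply: eq_bigr => j _.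
rewrite !linearZ; congr (_ *: _).
suff -> : delta_mx i j = tens (vbasis {:V})`_i (vbasis {:W})`_j by apply: fg.
apply/matrixP => a b; rewrite !mxE !coord_free ?(basis_free (vbasisP _)) //.
by rewrite -natrM mulnb ![_ == a]eq_sym ![_ == b]eq_sym.
Qed.

Definition tmap V V' W W' (f : V -> V') (g : W -> W') :
    tensor V W -> tensor V' W' :=
  tlift (fun v w => tens (f v) (g w)).

Definition tswap V W : tensor V W -> tensor W V := tlift (fun v w => tens w v).

Definition tassoc U V W : tensor (tensor U V) W -> tensor U (tensor V W) :=
  tlift (fun s w => tlift (fun u v => tens u (tens v w)) s).

Definition tmul (A B : falgType k) (s t : tensor A B) : tensor A B :=
  tlift (fun a b => tlift (fun c d => tens (a * c) (b * d)) t) s.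

End Tensor.

(* Finite dimensional k-algebras are falgType's, not necessarily commutative;
   the only restriction is that 0 != 1, which the counit forces anyway. *)
Record hopf_structure (k : fieldType) (H : falgType k) := HopfStructure {
  comul : {linear H -> tensor H H};
  counit : {linear H -> k^o};
  antipode : {linear H -> H};
  comulA : forall h, tassoc (tmap comul idfun (comul h))
                     = tmap idfun comul (comul h);
  counit_comull : forall h, tlift (fun a b => counit a *: b) (comul h) = h;
  counit_comulr : forall h, tlift (fun a b => counit b *: a) (comul h) = h;
  comul1 : comul 1 = tens 1 1;
  comulM : forall g h, comul (g * h) = tmul (comul g) (comul h);
  counit1 : counit 1 = 1;
  counitM : forall g h, counit (g * h) = counit g * counit h;
  antipodel : forall h,
    tlift (fun a b => antipode a * b) (comul h) = counit h *: 1;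
  antipoder : forall h,
    tlift (fun a b => a * antipode b) (comul h) = counit h *: 1
}.

Definition cocommutative (k : fieldType) (H : falgType k)
    (hH : hopf_structure H) : Prop :=
  forall h, tswap (comul hH h) = comul hH h.

Record module_algebra (k : fieldType) (H : falgType k) (hH : hopf_structure H)
    (A : falgType k) (act : {linear H -> 'End(A)}) : Prop := ModuleAlgebra {
  act1 : act 1 = \1%VF;
  actM : forall g h, act (g * h) = (act g \o act h)%VF;
  act_one : forall h, act h 1 = counit hH h *: 1;
  act_mul : forall h x y,
    act h (x * y) = tlift (fun a b => act a x * act b y) (comul hH h)
}.

(* \o%VF is ordinary composition, so s \otimes h is sent to t |-> s * (h t). *)
Definition galois_map (k : fieldType) (L H : falgType k)
    (act : {linear H -> 'End(L)}) : tensor L H -> 'End(L) :=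
  tlift (fun s h => (amull s \o act h)%VF).

Definition hopf_galois (k : fieldType) (L : fieldExtType k) : Prop :=
  exists (H : falgType k) (hH : hopf_structure H) (act : {linear H -> 'End(L)}),
    [/\ cocommutative hH, module_algebra hH act & bijective (galois_map act)].

(* M is a Galois closure of K over the base field k, inside the ambient L:
   the smallest Galois extension of k containing K. *)
Definition galois_closure (k : fieldType) (L : splittingFieldType k)
    (K M : {subfield L}) : Prop :=
  [/\ (K <= M)%VS, galois 1 M &
      forall N : {subfield L}, (K <= N)%VS -> galois 1 N -> (M <= N)%VS].

(* Main.v *)
(* By the construction of Greither and Pareigis, a Hopf Galois structure on F/k
   gives a regular group N of permutations of the set S of k-embeddings of F into
   the Galois closure, normalised by G = Gal(Kt/k): for embeddings x and y there is
   a unique element \sum_i e_i (x) h_i of Kt (x) H with y = \sum_i e_i (x o h_i);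
   it is group-like, hence acts on all of S, and these permutations form N.
   As |N| = |S| divides 360, it then suffices that a simple group G of order 360
   acts trivially on any group N of order a proper divisor of 360: then G
   commutes with a transitive group, so point stabilisers in G are trivial and
   |S| is 1 or 360, that is, F = k or F = Kt.  For the triviality, an element of
   order 5 centralises every invariant p-subgroup of N, because fixed points are
   counted modulo 5 and the Sylow subgroups have order 2, 4, 8, 3, 9 or 5.  This
   settles the orders prime to 5; otherwise N has 1, 6 or 36 Sylow 5-subgroups. *)

Require Import Defs.
From HB Require Import structures.
From mathcomp Require Import all_boot all_order all_algebra.
From mathcomp Require Import all_fingroup all_solvable all_field.
From mathcomp Require Import vcharacter.

Set Implicit Arguments.
Unset Strict Implicit.
Unset Printing Implicit Defensive.

Import GroupScope.

(** * Actions of a simple group of order 360 *)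

(** The fixed points of P acting on Q by conjugation form ['C_Q(P)], whose order divides that of Q
    and is congruent to it modulo p. *)
Lemma pgroup_cent_of_fix_mod (gT : finGroupType) (p : nat) (P Q : {group gT}) :
    p.-group P -> P \subset 'N(Q) ->
    (forall d, d %| #|Q| -> d = #|Q| %[mod p] -> d = #|Q|) ->
  P \subset 'C(Q).
Proof.
move=> pP nQP uniq_d; rewrite centsC; apply/setIidPl/eqP.
rewrite eqEcard subsetIl (uniq_d #|'C_Q(P)|) ?leqnn ?cardSg ?subsetIl //.
by rewrite -afixJ -pgroup_fix_mod // astabsJ.
Qed.

(** None of the listed orders has a proper divisor congruent to it modulo 5. The order 6 is absent
    because 6 and 1 are congruent. *)
Lemma group5_cent_small (gT : finGroupType) (P Q : {group gT}) :
    5.-group P -> P \subset 'N(Q) -> #|Q| \in [:: 1; 2; 3; 4; 5; 8; 9]%N ->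
  P \subset 'C(Q).
Proof.
move=> pP nQP oQ; apply: (pgroup_cent_of_fix_mod pP nQP) => d dvd /eqP eq_d.
rewrite dvdn_divisors // in dvd; apply/eqP; apply/implyP: eq_d; move: d dvd.
by apply/allP; move: oQ; rewrite !inE => /or4P[/eqP->|/eqP->|/eqP->|
  /or4P[/eqP->|/eqP->|/eqP->|/eqP->]].
Qed.

(** The number of Sylow p-subgroups divides 72, so it is prime to 5 and P normalises one of them.
    Its order divides 8 or 9, so P centralises it. With this for every p, the order of N divides
    that of ['C_N(P)]. *)
Lemma group5_cent_dvd72 (gT : finGroupType) (P N : {group gT}) :
  5.-group P -> P \subset 'N(N) -> #|N| %| 72 -> P \subset 'C(N).
Proof.
move=> pP nNP oN; rewrite centsC; apply/setIidPl/eqP.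
rewrite eqEcard subsetIl dvdn_leq //; apply/dvdn_partP=> // p.
rewrite mem_primes => /and3P[p_pr _ p_dvd].
have [S sylS nSP]: exists2 S : {group gT}, p.-Sylow(N) S & P \subset 'N(S).
  have nSylP: [acts P, on 'Syl_p(N) | 'JG].
    apply/actsP=> x Px Q; rewrite !inE.
    by rewrite -{1}(normsP nNP x Px) pHallJ2.
  have : #|'Syl_p(N)| %| 72 by apply: dvdn_trans (card_Syl_dvd _ _) oN.
  have := pgroup_fix_mod pP nSylP.
  have [-> | [S]] := set_0Vmem 'Fix_('Syl_p(N) | 'JG)(P).
    rewrite cards0 dvdn_divisors // => /eqP Syl0 Syl72.
    have/allP/(_ _ Syl72): all (fun d => d != 0 %[mod 5]) (divisors 72) by [].
    by rewrite Syl0.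
  by case/setIP; rewrite inE afixJG; exists S.
have oS: #|S| \in [:: 1; 2; 3; 4; 5; 8; 9]%N.
  have p72: p \in primes 72 by rewrite mem_primes p_pr (dvdn_trans p_dvd).
  have: #|S| %| p ^ logn p 72 by rewrite (card_Hall sylS) -p_part partn_dvd.
  rewrite dvdn_divisors ?expn_gt0 ?prime_gt0 //; move: p72 #|S|.
  by rewrite !inE => /orP[] /eqP-> d; move: d; apply/allP.
rewrite -(card_Hall sylS) cardSg // subsetI (pHall_sub sylS) centsC.
exact: group5_cent_small.
Qed.

(** Since [N, G, G] and [G, N, G] are trivial, so is [G, G, N] by the three subgroup lemma, and
    [G, G] is G. *)
Lemma perfect_cent_chain (gT : finGroupType) (G M N : {group gT}) :
  G^`(1) = G -> G \subset 'C(M) -> [~: N, G] \subset M -> G \subset 'C(N).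
Proof.
move=> perfG cMG sNGM; have NGG: [~: N, G, G] = 1.
  by apply/commG1P; rewrite centsC (subset_trans cMG) ?centS.
apply/commG1P; rewrite -{1}perfG; apply: three_subgroup => //.
by rewrite (commGC G).
Qed.

(** The kernel of the action of G on N / M is normal in G and contains the nontrivial P, so it is
    G. *)
Lemma simple_cent_quotient (gT : finGroupType) (G P M N : {group gT}) :
    simple G -> P \subset G -> P :!=: 1 -> G \subset 'N(N) -> G \subset 'N(M) ->
    M <| N -> P / M \subset 'C(N / M) -> [~: N, G] \subset M.
Proof.
move=> /simpleP[ntG simpG] sPG ntP nNG nMG nsMN cNP.
have [sMN nMN] := andP nsMN.
have nsCG: 'C_G(N / M | 'Q) <| G.
  rewrite /normal subsetIl normsI ?normG //= astabQ.
  rewrite (subset_trans _ (morphpre_norm _ _)) // -sub_quotient_pre //.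
  by rewrite (subset_trans _ (cent_norm _)) // quotient_norms.
have sPC: P \subset 'C_G(N / M | 'Q).
  by rewrite subsetI sPG sub_astabQ (subset_trans sPG).
case: (simpG _ nsCG) => [C1 | CG].
  by rewrite C1 subG1 (negPf ntP) in sPC.
have: G \subset 'C(N / M | 'Q) by rewrite -CG subsetIr.
by rewrite sub_astabQ nMG /= quotient_cents2 // commGC.
Qed.

(** Two distinct conjugates of a group of prime order meet trivially, and only elements of Q
    normalise Q. *)
Lemma Frobenius_prime_self_norm (gT : finGroupType) (N Q : {group gT}) :
    prime #|Q| -> Q \subset N -> Q :!=: N -> 'N_N(Q) = Q ->
  [Frobenius N with complement Q].
Proof.
move=> pr_Q sQN neqQN NQ; apply/andP; split=> //; apply/normedTI_P; split.
- by rewrite setD_eq0 subG1 -cardG_gt1 prime_gt1.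
- by rewrite normD1 NQ.
move=> g Ng; apply: contraR; rewrite -setI_eq0 conjD1g -setDIl setD_eq0 subG1.
rewrite -{1}NQ inE Ng /= => nQg; apply/eqP/prime_TIg => //.
by apply: contra nQg => sQQg; rewrite -groupV inE sub_conjgV.
Qed.

Lemma simple_quotient_cent (gT : finGroupType) (G P M N : {group gT}) :
    simple G -> G^`(1) = G -> P \subset G -> P :!=: 1 -> G \subset 'N(N) ->
    M <| N -> G \subset 'C(M) -> P / M \subset 'C(N / M) -> G \subset 'C(N).
Proof.
move=> simpG perfG sPG ntP nNG nsMN cMG cNP.
apply: (perfect_cent_chain perfG cMG).
exact: simple_cent_quotient simpG sPG ntP nNG (cents_norm cMG) nsMN cNP.
Qed.

Lemma simple_sub_cent (gT : finGroupType) (G P N : {group gT}) :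
    simple G -> P \subset G -> P :!=: 1 -> G \subset 'N(N) ->
  P \subset 'C(N) -> G \subset 'C(N).
Proof.
move=> /simpleP[_ simpG] sPG ntP nNG cNP.
have nsCG: 'C_G(N) <| G by rewrite /normal subsetIl normsI ?normG ?norms_cent.
case: (simpG _ nsCG) => [C1 | <-]; last exact: subsetIr.
by case/negP: ntP; rewrite -subG1 -C1 subsetI sPG.
Qed.

Lemma simple_nonprime_perfect (gT : finGroupType) (G : {group gT}) :
  simple G -> ~~ prime #|G| -> G^`(1) = G.
Proof.
move=> simpG; have [_ /(_ _ (der_normal 1 G))[G'1 | //]] := simpleP _ simpG.
case/negP; apply: simple_sol_prime => //; apply: abelian_sol.
by rewrite (sameP derG1P eqP) G'1.
Qed.

(* Otherwise G embeds in Sym(S) with index 2, and the image of N contains the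
   image of G or meets it trivially; then N has order at least 360, or its image
   has order at most 2 and is not transitive. *)
Lemma simple360_trans6 (aT : finGroupType) (rT : finType)
    (to : {action aT &-> rT}) (S : {set rT}) (G N : {group aT}) :
    simple G -> #|G| = 360 -> G \subset 'N(N) -> #|N| < 360 -> #|S| = 6 ->
    [acts G, on S | to] -> [transitive N, on S | to] ->
  G \subset 'C(S | to).
Proof.
move=> simpG oG nNG ltN oS actG trN.
have actN := atrans_acts trN; have actA : [acts N <*> G, on S | to].
  by rewrite join_subG actN.
have [sNA sGA] := joing_sub (erefl (N <*> G)).
pose f := actperm <[actA]>.
have sfSym (B : {group aT}) : f @* B \subset perm_on S.
  apply/subsetP=> _ /morphimP[a Aa _ ->]; apply/subsetP=> x.
  by rewrite inE actpermE /= /actby; case: ifP => [/andP[] //|_]; rewrite eqxx.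
have [_ simpG'] := simpleP _ simpG.
have nsKG: 'ker_G f <| G by exact: normalGI sGA (ker_normal _).
case: (simpG' _ nsKG) => [K1 | KG]; last first.
  rewrite -KG; apply/subsetP=> a /setIP[Ga /kerP fa].
  apply/astabP=> x Sx; have:= congr1 (fun g : {perm rT} => g x) (fa _).
  by rewrite perm1 actpermE /= actbyE // (subsetP sGA) //; apply.
have isoG: G \isog f @* G.
  have <-: restrm sGA f @* G = f @* G by rewrite morphim_restrm setIid.
  by rewrite sub_isog // ker_restrm K1.
have ofG : #|f @* G| = 360 by rewrite -(card_isog isoG).
have [_ simpfG] := simpleP _ (etrans (esym (isog_simple isoG)) simpG).
have trfN: [transitive f @* N, on S | 'P].
  have [x Sx defS] := imsetP trN; apply/imsetP; exists x => //.
  rewrite orbit_morphim_actperm // {1}defS; apply: eq_in_imset => a Na.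
  by rewrite actbyE // (subsetP sNA).
have fN6: 6 <= #|f @* N| by rewrite -oS dvdn_leq // (atrans_dvd trfN).
have nsI: f @* G :&: f @* N <| f @* G.
  by rewrite /normal subsetIl normsI ?normG ?morphim_norms.
case: (simpfG _ nsI) => [I1 | /setIidPl/subset_leq_card]; last first.
  by rewrite ofG leqNgt (leq_ltn_trans (leq_morphim _ _)).
have: f @* G * f @* N \subset perm_on S.
  by apply: subset_trans (sfSym (N <*> G)); rewrite mul_subG ?morphimS.
move/subset_leq_card; rewrite TI_cardMg // card_perm oS ofG.
by rewrite leqNgt (leq_trans _ (leq_mul (leqnn 360) fN6)).
Qed.

Lemma simple360_norm_cent (gT : finGroupType) (G N : {group gT}) :
    simple G -> #|G| = 360 -> G \subset 'N(N) -> #|N| %| 360 -> #|N| < 360 ->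
  G \subset 'C(N).
Proof.
move=> simpG oG nNG oN ltN.
have perfG: G^`(1) = G by rewrite simple_nonprime_perfect ?oG.
have [P sylP] := Sylow_exists 5 G; have sPG := pHall_sub sylP.
have pP := pHall_pgroup sylP.
have oP: #|P| = 5 by rewrite (card_Hall sylP) oG p_part.
have ntP: P :!=: 1 by rewrite -cardG_gt1 oP.
have nNP := subset_trans sPG nNG.
have [n5 | n5] := boolP (5 %| #|N|); last first.
  apply: (simple_sub_cent simpG sPG) => //; apply: group5_cent_dvd72 => //.
  by rewrite -(Gauss_dvdl _ (_ : coprime _ 5)) // coprime_sym prime_coprime.
have [Q sylQ] := Sylow_exists 5 N; have sQN := pHall_sub sylQ.
have [m oNm] := dvdnP n5.
have m72: m \in divisors 72.
  by rewrite -dvdn_divisors // -(@dvdn_pmul2r 5) // -oNm.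
have ltm: m < 72 by rewrite -(@ltn_pmul2r 5) // -oNm.
have m5: ~~ (5 %| m).
  by move: m m72 {oNm ltm}; apply/allP.
have oQ: #|Q| = 5.
  rewrite (card_Hall sylQ) oNm p_part lognM ?(dvdn_gt0 _ (_ : m %| 72)) //.
    by rewrite lognE (negPf m5) andbF.
  by rewrite dvdn_divisors.
pose s := #|'Syl_5(N)|.
have s5: s == 1 %[mod 5] by rewrite card_Syl_mod.
have sm: s %| m.
  rewrite /s (card_Syl sylQ) -(@dvdn_pmul2l #|'N_N(Q)|) ?cardG_gt0 //.
  rewrite Lagrange ?subsetIl // oNm mulnC dvdn_mul // -oQ.
  by rewrite cardSg // subsetI sQN normG.
(* These are the divisors of 72 congruent to 1 modulo 5. *)
have s_in: s \in [:: 1; 6; 36]%N.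
  have: s %| 72 by rewrite (dvdn_trans sm) ?dvdn_divisors.
  rewrite dvdn_divisors //; move: s s5 {sm} => d d5 dd; apply/implyP: d5.
  by move: d dd; apply/allP.
have nSylG: [acts G, on 'Syl_5(N) | 'JG].
  apply/actsP=> x Gx R; rewrite !inE.
  by rewrite -{1}(normsP nNG x Gx) pHallJ2.
have [cGSyl | ncGSyl] := boolP (G \subset 'C('Syl_5(N) | 'JG)).
  (* G centralises the subgroup generated by the 5-elements, whose quotient has
     order prime to 5. *)
  pose E := [set x in N | 5.-elt x].
  have cGE: G \subset 'C(E).
    rewrite centsC; apply/subsetP=> x; rewrite inE => /andP[Nx x5].
    have sxN: <[x]> \subset N by rewrite cycle_subG.
    have [R sylR sxR] := Sylow_superset sxN x5.
    have nRG: G \subset 'N(R).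
      rewrite -astab1JG (subset_trans cGSyl) // astabS // sub1set inE.
      exact: sylR.
    have nRP := subset_trans sPG nRG.
    have oR: #|R| = 5 by rewrite (card_Hall sylR) -(card_Hall sylQ).
    have cGR: G \subset 'C(R).
      by rewrite (simple_sub_cent simpG sPG) // group5_cent_small // oR.
    by rewrite -sub_cent1 (subset_trans cGR) // -cent_cycle centS.
  have sEN: E \subset N by apply/subsetP=> x; rewrite inE => /andP[].
  have nEN: N \subset 'N(E).
    apply/subsetP=> x Nx; rewrite inE; apply/subsetP=> _ /imsetP[y + ->].
    by rewrite !inE => /andP[Ny y5]; rewrite groupJ // p_eltJ.
  have nsEN: <<E>> <| N by rewrite /normal gen_subG sEN norms_gen.
  have cGgE: G \subset 'C(<<E>>) by rewrite cent_gen.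
  apply: (simple_quotient_cent simpG perfG sPG ntP nNG nsEN cGgE).
  apply: group5_cent_dvd72; rewrite ?quotient_pgroup ?quotient_norms //.
  have sQE: Q \subset <<E>>.
    apply: subset_trans (subset_gen E); apply/subsetP=> x Qx; rewrite inE.
    by rewrite (subsetP sQN) // (mem_p_elt (pHall_pgroup sylQ)).
  rewrite card_quotient ?normal_norm // (dvdn_trans (indexgS _ sQE)) //.
  by rewrite -divgS // oNm oQ mulnK // dvdn_divisors.
(* A unique Sylow subgroup would be fixed by G; six are permuted transitively by N, so
   [simple360_trans6] makes G fix each of them. Both contradict [ncGSyl]. *)
move: s_in; rewrite !inE => /or3P[] /eqP s_eq.
- case/negP: ncGSyl.
  have /cards1P[R defS] : #|'Syl_5(N)| == 1%N by rewrite -/s s_eq.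
  rewrite defS astab1JG; apply/subsetP=> x Gx.
  have: ('JG R x)%act \in 'Syl_5(N) by rewrite (actsP nSylG) // defS set11.
  by rewrite defS inE => /eqP defR; apply/normP; rewrite -[in RHS]defR.
- by case/negP: ncGSyl; apply: simple360_trans6 (Syl_trans 5 N).
(* With 36 Sylow 5-subgroups, N is a Frobenius group of order 180 with complement
   Q, and its kernel K of order 36 is characteristic. *)
have m36: m = 36.
  have [q Dm] := dvdnP sm; move: m72 ltm; rewrite Dm s_eq.
  by case: q {Dm} => [|[|q]] // _; rewrite !mulSn; move/leq_trans.
have NQ: 'N_N(Q) = Q.
  apply/esym/eqP; rewrite eqEcard subsetI sQN normG /= oQ.
  rewrite -(@leq_pmul2r 36) // -{1}s_eq /s (card_Syl sylQ).
  by rewrite Lagrange ?subsetIl // oNm m36.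
have neqQN: Q :!=: N by apply: contra_eq_neq oNm => <-; rewrite oQ m36.
have prQ: prime #|Q| by rewrite oQ.
have frobQ := Frobenius_prime_self_norm prQ sQN neqQN NQ.
have [K frobK] := Frobenius_kernel_exists frobQ.
have [defN _ _ _ _] := Frobenius_context frobK.
have oK: #|K| = 36.
  by apply/eqP; rewrite -(@eqn_pmul2r 5) // -{1}oQ (sdprod_card defN) oNm m36.
have [nsKN _ _ _ _] := sdprod_context defN.
(* As a normal Hall subgroup, K is a [pcore] of N, hence characteristic. *)
have nKG: G \subset 'N(K).
  rewrite -(normal_Hall_pcore (Hall_pi (Frobenius_ker_Hall frobK)) nsKN).
  exact: char_norm_trans (pcore_char _ _) nNG.
have nKP := subset_trans sPG nKG.
have cGK: G \subset 'C(K).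
  by rewrite (simple_sub_cent simpG sPG) // group5_cent_dvd72 // oK.
(* The quotient N / K has order 5, so the image of P centralises it. *)
apply: (simple_quotient_cent simpG perfG sPG ntP nNG nsKN cGK).
apply: group5_cent_small; rewrite ?quotient_pgroup ?quotient_norms //.
rewrite card_quotient ?normal_norm // -divgS ?normal_sub // oK oNm m36.
by rewrite !inE.
Qed.

(** * Regular permutation groups normalised by a simple group *)

(* Think of [vec a b] as the vector from a to b in an affine space: its
   translations form a regular group. *)
Lemma translation_group (gT : finGroupType) (rT : finType) (E : eqType)
    (to : {action gT &-> rT}) (G : {group gT}) (S : {set rT})
    (vec : rT -> rT -> E) :
    [acts G, on S | to] -> S != set0 ->
    {in S & &, forall a b b', vec a b = vec a b' -> b = b'} ->
    {in S & &, forall a b a', exists2 b', b' \in S & vec a' b' = vec a b} ->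
    (forall a b c a' b' c', [/\ a \in S, b \in S & c \in S] ->
       [/\ a' \in S, b' \in S & c' \in S] ->
       vec a b = vec a' b' -> vec b c = vec b' c' -> vec a c = vec a' c') ->
    {in S &, forall a b, vec a a = vec b b} ->
    (forall g a b a' b', g \in G -> [/\ a \in S & b \in S] ->
       [/\ a' \in S & b' \in S] -> vec a b = vec a' b' ->
       vec (to a g) (to b g) = vec (to a' g) (to b' g)) ->
  exists N : {group {perm rT}},
    [/\ [transitive N, on S | 'P], #|N| = #|S| & actperm to @* G \subset 'N(N)].
Proof.
move=> actG /set0Pn[o So] vecI vecE vecD vec0 vecG.
(* The translations of S, extended by the identity outside S so that each is determined by its
   vector. *)
pose Nset := [set s : {perm rT} | perm_on S s &&
  [forall a in S, vec a (s a) == vec o (s o)]].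
have memN (s : {perm rT}) :
    reflect (perm_on S s /\ {in S, forall a, vec a (s a) = vec o (s o)})
            (s \in Nset).
  rewrite inE; apply: (iffP andP) => -[Ss vs]; split=> //.
    by move=> a Sa; apply/eqP/(forall_inP vs).
  by apply/forall_inP=> a Sa; rewrite vs.
have NS s : s \in Nset -> forall a, (s a \in S) = (a \in S).
  by case/memN=> Ss _ a; apply: perm_closed.
have grN : group_set Nset.
  apply/group_setP; split=> [|s t Ns Nt].
    by apply/memN; split=> [|a Sa]; rewrite ?perm_on1 // !perm1 (vec0 a o).
  have [/memN[Ss vs] /memN[St vt]] := (Ns, Nt).
  apply/memN; split=> [|a Sa]; first exact: perm_onM.
  rewrite !permM; apply: (vecD _ (s a) _ _ (s o)).
  - by rewrite !(NS _ Nt, NS _ Ns).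
  - by rewrite !(NS _ Nt, NS _ Ns).
  - exact: vs.
  - by rewrite vt ?(NS _ Ns) // [RHS]vt ?(NS _ Ns).
pose N := Group grN.
have trN b : b \in S -> exists2 s, s \in N & s o = b.
  (* [p u v a] is the endpoint of the vector from u to v laid off at a. The [odflt] default never
     occurs for u, v, a in S, by [vecE]. *)
  move=> Sb; pose q u v a c := (c \in S) && (vec a c == vec u v).
  pose p u v a := if a \in S then odflt a [pick c | q u v a c] else a.
  have pP u v a : u \in S -> v \in S -> a \in S ->
      p u v a \in S /\ vec a (p u v a) = vec u v.
    rewrite /p => Su Sv Sa; rewrite Sa.
    case: pickP => [c /andP[Sc /eqP] // | nop].
    by have [c Sc vc] := vecE u v a Su Sv Sa; case/andP: (nop c); rewrite vc.
  have pS a : (p o b a \in S) = (a \in S).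
    case Sa: (a \in S); last by rewrite /p Sa.
    by have [] := pP o b a.
  have pK : cancel (p o b) (p b o).
    move=> a; case Sa: (a \in S); last by rewrite /p Sa /p Sa.
    have [//|//||Sc vc] := pP o b a; first by [].
    have [//|//||Sd vd] := pP b o (p o b a); first by [].
    apply: (vecI a) => //; rewrite (vec0 a o) //.
    exact: (vecD a (p o b a) _ o b o).
  exists (perm (can_inj pK)); last first.
    rewrite permE; apply: (vecI o) => //; first by rewrite pS.
    by have [] := pP o b o.
  apply/memN; split=> [|a Sa].
    by apply/subsetP=> a; rewrite inE permE /p; case: ifP => //; rewrite eqxx.
  rewrite !permE; have [//|//||_ ->] := pP o b a; first by [].
  by have [//|//||_ ->] := pP o b o.
have defS : orbit 'P N o = S.
  apply/setP=> b; apply/imsetP/idP=> [[s Ns ->] | /trN[s Ns <-]].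
    by rewrite /= apermE NS.
  by exists s.
(* A translation fixing o has the zero vector, so it fixes every point; hence N is regular on S. *)
have fixN s : s \in N -> s o = o -> s = 1.
  move=> Ns so; have [Ss vs] := memN s Ns; apply/permP=> a; rewrite perm1.
  case Sa: (a \in S); last by apply: out_perm Ss _; rewrite Sa.
  by apply: (vecI a); rewrite ?NS // vs // so (vec0 o a).
exists N; split; first by apply/imsetP; exists o.
  rewrite -defS card_orbit.
  have ->: 'C_N[o | 'P] = 1; last by rewrite indexg1.
  apply/trivgP/subsetP=> s /setIP[Ns /astab1P so].
  by rewrite inE (fixN s).
apply/subsetP=> _ /morphimP[g _ Gg ->]; rewrite inE.
apply/subsetP=> _ /imsetP[s Ns ->]; have [Ss vs] := memN s Ns.
have conjE a : (s ^ actperm to g) a = to (s (to a g^-1)) g.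
  by rewrite -[a in LHS](actKV to g) -actpermE permJ actpermE.
have actS h a : h \in G -> (to a h \in S) = (a \in S).
  by move=> Gh; rewrite (acts_act actG).
apply/memN; split=> [|a Sa].
  apply/subsetP=> a; rewrite inE conjE; apply: contraR => nSa.
  by rewrite (out_perm Ss) ?actKV // actS ?groupV.
(* The vector of the conjugate at a is the g-image of the vector of s at [to a g^-1], which equals
   its vector at [to o g^-1]. *)
have := vecG g (to a g^-1) (s (to a g^-1)) (to o g^-1) (s (to o g^-1)) Gg.
by rewrite !conjE !actKV; apply; rewrite ?NS ?actS ?groupV // !vs ?actS ?groupV.
Qed.

(** By simplicity G acts on S trivially, and then S is a point, or faithfully, and then
    [simple360_norm_cent] applies to its image unless S already has 360 elements. *)
Lemma regular_normalised_card (gT : finGroupType) (rT : finType)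
    (to : {action gT &-> rT}) (G : {group gT}) (S : {set rT})
    (N : {group {perm rT}}) :
    simple G -> #|G| = 360 -> [transitive G, on S | to] ->
    [transitive N, on S | 'P] -> #|N| = #|S| -> actperm to @* G \subset 'N(N) ->
  #|S| = 1%N \/ #|S| = 360.
Proof.
move=> simpG oG trG trN oN nNG; have [_ simpG'] := simpleP _ simpG.
have [o So defS] := imsetP trG.
have nsK: 'C_G(S | to) <| G.
  rewrite /normal subsetIl normsI ?normG //.
  exact: subset_trans (atrans_acts trG) (astab_norm _ _).
case: (simpG' _ nsK) => [K1 | KG]; [right | left]; last first.
  have -> : S = [set o]; last by rewrite cards1.
  apply/setP=> x; rewrite inE; apply/idP/eqP=> [|-> //].
  rewrite defS => /imsetP[g + ->]; rewrite -KG => /setIP[_ cg].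
  by rewrite (astab_act cg).
have [/eqP // | neS] := boolP (#|S| == 360).
have dvS : #|S| %| 360 by rewrite -oG (atrans_dvd trG).
have injG: 'injm (restrm (subsetT G) (actperm to)).
  rewrite ker_restrm ker_actperm -K1 setIS // astabS // subsetT.
have isoG: G \isog actperm to @* G.
  have <-: restrm (subsetT G) (actperm to) @* G = actperm to @* G.
    by rewrite morphim_restrm setIid.
  by rewrite sub_isog.
have cNG: actperm to @* G \subset 'C(N).
  apply: simple360_norm_cent => //; rewrite ?oN //.
  - by rewrite -(isog_simple isoG).
  - by rewrite -(card_isog isoG).
  by rewrite ltn_neqAle neS dvdn_leq.
(* An element fixing o and commuting with N fixes the whole N-orbit of o, which is S. *)
have stab1: 'C_G[o | to] = 1.
  apply/trivgP; rewrite -K1 subsetI subsetIl.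
  apply/subsetP=> g /setIP[Gg /astab1P go].
  apply/astabP=> x Sx; have [s Ns ->] := atransP2 trN So Sx.
  have := centsP cNG _ (mem_morphim (actperm_morphism to) (in_setT g) Gg) _ Ns.
  move/(congr1 (fun u : {perm rT} => u o)).
  by rewrite /= !permM !actpermE go.
by rewrite defS card_orbit stab1 indexg1 oG.
Qed.

Import GRing.Theory.
Local Open Scope ring_scope.

(** * Group-like elements and embeddings *)


Section GaloisMap.
Variables (k : fieldType) (A : fieldExtType k) (H : falgType k).
Variable act : {linear H -> 'End(A)}.
Local Notation a_ i := (vbasis {:A})`_i.
Local Notation h_ i := (vbasis {:H})`_i.

Lemma galois_mapE (t : tensor A H) v :
  galois_map act t v =
    \sum_j (\sum_i (t : 'M_(_, _)) i j *: a_ i) * act (h_ j) v.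
Proof.
rewrite /galois_map /tlift exchange_big sum_lfunE; apply: eq_bigr => j _.
rewrite sum_lfunE mulr_suml; apply: eq_bigr => i _.
by rewrite scale_lfunE comp_lfunE lfunE /= scalerAl.
Qed.

Hypothesis bij_act : bijective (galois_map act).

(** With [galois_map_free], this says that the operators [act (h_ i)] form a basis of End(A) as a
    left A-space. *)
Lemma galois_map_surj (phi : A -> A) : linear phi ->
  exists s : 'I_(\dim {:H}) -> A,
    forall v, phi v = \sum_i s i * act (h_ i) v.
Proof.
move=> lphi; have [g _ gK] := bij_act.
pose phi_lin : {linear A -> A} :=
  HB.pack phi (GRing.isLinear.Build k A A _ phi lphi).
exists (fun j => \sum_i (g (linfun phi_lin) : 'M_(_, _)) i j *: a_ i) => v.
by rewrite -galois_mapE gK lfunE.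
Qed.

Lemma galois_map_free (s : 'I_(\dim {:H}) -> A) :
  (forall v, \sum_i s i * act (h_ i) v = 0) -> forall i, s i = 0.
Proof.
move=> s0 i; pose t : tensor A H := \matrix_(j, i) coord (vbasis {:A}) j (s i).
have ts m : \sum_j (t : 'M_(_, _)) j m *: a_ j = s m.
  rewrite [RHS](coord_vbasis (memvf _)).
  by apply: eq_bigr => j _; rewrite mxE.
have t0: t = 0.
  apply: (bij_inj bij_act); apply/lfunP => v; rewrite !galois_mapE.
  transitivity (0 : A).
    by rewrite -[RHS](s0 v); apply: eq_bigr => m _; rewrite ts.
  rewrite big1 // => m _; rewrite big1 ?mul0r // => j _.
  by rewrite mxE scale0r.
by rewrite -ts t0 big1 // => j _; rewrite mxE scale0r.
Qed.

(* C j i is the i-th coordinate of the rank one map [coord j] in the left A-basis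
   (h_i) of End(A). *)
Lemma galois_map_dual :
  exists C : 'I_(\dim {:A}) -> 'I_(\dim {:H}) -> A,
    (forall j v, \sum_i C j i * act (h_ i) v = (coord (vbasis {:A}) j v)%:A)
    /\ (forall i i' : 'I_(\dim {:H}),
         \sum_(j < \dim {:A}) act (h_ i) (a_ j) * C j i' = (i == i')%:R).
Proof.
have /fin_all_exists[C defC] (j : 'I_(\dim {:A})) :
    exists s : 'I_(\dim {:H}) -> A,
      forall v, (coord (vbasis {:A}) j v)%:A = \sum_i s i * act (h_ i) v.
  apply: galois_map_surj => c u v.
  by rewrite linearP /= scalerDl scalerA.
exists C; split=> [j v | i i']; first by rewrite defC.
(* Both sides are the coefficients of [act (h_ i)] in the basis of the [act (h_ i')]: expand v in
   the basis [a_ j], then use the first identity. *)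
apply/eqP; rewrite -subr_eq0; apply/eqP.
move: i'; apply: galois_map_free => v.
have sum_delta: \sum_i' (i == i')%:R * act (h_ i') v = act (h_ i) v.
  rewrite (bigD1 i) //= eqxx mul1r big1 ?addr0 // => i' /negPf ne_i'.
  by rewrite eq_sym ne_i' mul0r.
under eq_bigr => i' _ do rewrite mulrBl mulr_suml.
rewrite sumrB exchange_big {}sum_delta /=.
apply/eqP; rewrite subr_eq0; apply/eqP.
rewrite [in RHS](coord_vbasis (memvf v)) linear_sum /=; apply: eq_bigr => j _.
under eq_bigr => i' _ do rewrite -mulrA.
by rewrite -mulr_sumr -defC linearZ /= -scalerAr mulr1.
Qed.
End GaloisMap.

(** * Transport of embeddings by elements of B (x) H *)

Section Transport.
Variables (k : fieldType) (A B : fieldExtType k) (H : falgType k).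
Variables (hH : hopf_structure H) (act : {linear H -> 'End(A)}).
Hypothesis modA : module_algebra hH act.
Hypothesis bij_act : bijective (galois_map act).
Local Notation a_ i := (vbasis {:A})`_i.
Local Notation nA := (\dim {:A}).
Local Notation nH := (\dim {:H}).
Local Notation h_ i := (vbasis {:H})`_i.
Implicit Types (x y z : 'AHom(A, B)) (e : {ffun 'I_nH -> B}).

(* The element \sum_i e i (x) h_i of B (x) H sends x to y. *)
Definition transports e (x y : A -> B) :=
  forall t, y t = \sum_(i < nH) e i * x (act (h_ i) t).

(** Independence survives the passage from A to B: the matrix of the [x (act (h_ i) (a_ j))] has the
    right inverse [x (C j i')], since x preserves the second identity of [galois_map_dual]. *)
Lemma act_indep x (m : 'I_nH -> B) :
  (forall t, \sum_(i < nH) m i * x (act (h_ i) t) = 0) -> forall i, m i = 0.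
Proof.
have [C [_ C_dual]] := galois_map_dual bij_act => m0 i'.
transitivity
  (\sum_(j < nA) (\sum_(i < nH) m i * x (act (h_ i) (a_ j))) * x (C j i'));
  last first.
  by rewrite big1 // => j _; rewrite m0 mul0r.
under eq_bigr => j _ do rewrite mulr_suml.
rewrite exchange_big /= (bigD1 i') //= [X in _ + X]big1 ?addr0 => [|i ne_i].
  under eq_bigr => j _ do rewrite -mulrA -rmorphM.
  by rewrite -mulr_sumr -rmorph_sum C_dual eqxx rmorph1 mulr1.
under eq_bigr => j _ do rewrite -mulrA -rmorphM.
by rewrite -mulr_sumr -rmorph_sum C_dual (negPf ne_i) rmorph0 mulr0.
Qed.

Lemma transports_unique e e' x y :
  transports e x y -> transports e' x y -> e = e'.
Proof.
move=> exy e'xy; apply/ffunP=> i; apply/eqP; rewrite -subr_eq0; apply/eqP.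
move: i; apply: (@act_indep x) => t.
by under eq_bigr do rewrite mulrBl; rewrite sumrB -exy -e'xy subrr.
Qed.

Lemma transports_exist :
  exists vec : 'AHom(A, B) -> 'AHom(A, B) -> {ffun 'I_nH -> B},
  forall x y, transports (vec x y) x y.
Proof.
have [C [C_coord _]] := galois_map_dual bij_act.
(* Write y as the sum over j of [y (a_ j)] times the j-th coordinate, and expand each coordinate map
   in the [act (h_ i)] by means of C. *)
exists (fun x y => [ffun i => \sum_(j < nA) y (a_ j) * x (C j i)]) => x y t.
under eq_bigr => i _ do rewrite ffunE mulr_suml.
rewrite exchange_big /= [in LHS](coord_vbasis (memvf t)) linear_sum /=.
apply: eq_bigr => j _.
under eq_bigr => i _ do rewrite -mulrA -rmorphM.
rewrite -mulr_sumr -rmorph_sum C_coord linearZ /= [x _]linearZ /= rmorph1.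
by rewrite -scalerAr mulr1.
Qed.

(** The sum over i on the right is the coefficient at [h_ a] (x) [h_ b] of the comultiplication
    applied to e. *)
Lemma transports_mulE e x s t :
  \sum_(i < nH) e i * x (act (h_ i) (s * t)) =
  \sum_(a < nH) \sum_(b < nH)
    (\sum_(i < nH) (comul hH (h_ i) : 'M_(_, _)) a b *: e i)
    * x (act (h_ b) t) * x (act (h_ a) s).
Proof.
under eq_bigr => i _.
  rewrite (act_mul modA) /tlift linear_sum mulr_sumr.
  under eq_bigr => a _.
    rewrite linear_sum mulr_sumr.
    under eq_bigr => b _ do rewrite linearZ /= rmorphM -scalerAr scalerAl
      [x _ * x _]mulrC mulrA.
    over.
  over.
rewrite exchange_big /=; apply: eq_bigr => a _.
rewrite exchange_big /=; apply: eq_bigr => b _.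
by rewrite -!mulr_suml.
Qed.

(* Compare the coefficients of the independent x (h_a s) * x (h_b t) in
   y (s * t) = y s * y t. *)
Lemma transports_grouplike e x y : transports e x y -> forall a b,
  \sum_(i < nH) (comul hH (h_ i) : 'M_(_, _)) a b *: e i = e a * e b.
Proof.
move=> exy a b; apply/eqP; rewrite -subr_eq0; apply/eqP; move: b.
apply: (@act_indep x) => t; move: a; apply: (@act_indep x) => s.
have yst: y (s * t) = y s * y t by rewrite rmorphM.
rewrite !exy transports_mulE in yst.
have {}yst := etrans yst (mulr_suml _ _ _ _).
apply/eqP; move/eqP: yst; rewrite -subr_eq0 -sumrB; congr (_ == 0).
apply: eq_bigr => a _; rewrite mulr_suml mulr_sumr -sumrB.
apply: eq_bigr => b _; rewrite !mulrBl; congr (_ - _).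
by rewrite -!mulrA; congr (_ * _); rewrite mulrCA; congr (_ * _); rewrite mulrC.
Qed.

Lemma transports_counit e x y : transports e x y ->
  \sum_(i < nH) counit hH (h_ i) *: e i = 1.
Proof.
move=> exy; have <-: y 1 = 1 by rewrite rmorph1.
rewrite exy; apply: eq_bigr => i _.
by rewrite (act_one modA) linearZ /= rmorph1 -scalerAr mulr1.
Qed.

(** Being group-like is a condition on e alone, and it makes e carry any homomorphism x' to a
    multiplicative map. *)
Lemma transports_extend e x y x' : transports e x y ->
  exists y' : 'AHom(A, B), transports e x' y'.
Proof.
move=> exy.
pose f : 'Hom(A, B) := (\sum_(i < nH) (amull (e i) \o (x' \o act (h_ i))))%VF.
have fE t : f t = \sum_(i < nH) e i * x' (act (h_ i) t).
  rewrite sum_lfunE; apply: eq_bigr => i _.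
  by rewrite comp_lfunE lfunE /= comp_lfunE.
have f1 : f 1 = 1.
  rewrite fE -(transports_counit exy); apply: eq_bigr => i _.
  by rewrite (act_one modA) linearZ /= rmorph1 -scalerAr mulr1.
have fM s t : f (s * t) = f s * f t.
  rewrite !fE transports_mulE mulr_suml; apply: eq_bigr => a _.
  rewrite mulr_sumr; apply: eq_bigr => b _.
  rewrite (transports_grouplike exy) -!mulrA; congr (_ * _).
  by rewrite [RHS]mulrCA; congr (_ * _); rewrite mulrC.
have f_hom : ahom_in {:A} f by apply/ahom_inP; split=> // s t _ _; apply: fM.
by exists (AHom f_hom) => t; rewrite -fE.
Qed.

(** The witness is the product of e and e' in B (x) H, so it does not depend on the embeddings. *)
Lemma transports_comp e e' : exists e'', forall x y z,
  transports e x y -> transports e' y z -> transports e'' x z.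
Proof.
exists [ffun l => \sum_(i < nH) \sum_(j < nH)
  coord (vbasis {:H}) l (h_ j * h_ i) *: (e' i * e j)].
move=> x y z exy eyz t; rewrite eyz.
under [RHS]eq_bigr => l _ do rewrite ffunE mulr_suml.
rewrite exchange_big /=; apply: eq_bigr => i _.
under [RHS]eq_bigr => l _ do rewrite mulr_suml.
rewrite exchange_big exy mulr_sumr /=; apply: eq_bigr => j _.
rewrite -comp_lfunE -(Defs.actM modA) [h_ j * _](coord_vbasis (memvf _)).
rewrite linear_sum sum_lfunE linear_sum mulrA mulr_sumr; apply: eq_bigr => l _.
rewrite -(coord_vbasis (memvf _)) linearZ scale_lfunE linearZ /=.
by rewrite -scalerAr scalerAl.
Qed.

(** The witness is 1 (x) 1 in coordinates. *)
Lemma transports_id : exists e, forall x, transports e x x.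
Proof.
exists [ffun l => (coord (vbasis {:H}) l 1)%:A] => x t.
have {1}-> : t = act 1 t by rewrite (Defs.act1 modA) lfunE.
rewrite {1}(coord_vbasis (memvf 1)) linear_sum sum_lfunE linear_sum.
apply: eq_bigr => l _; rewrite ffunE linearZ scale_lfunE linearZ /=.
by rewrite -scalerAl mul1r.
Qed.

Lemma transports_post e (g : 'AEnd(B)) x y (x' y' : A -> B) :
    transports e x y -> x' =1 g \o x -> y' =1 g \o y ->
  transports [ffun i => g (e i)] x' y'.
Proof.
move=> exy x'E y'E t; rewrite y'E /= exy linear_sum; apply: eq_bigr => i _.
by rewrite ffunE x'E rmorphM.
Qed.

End Transport.

(** * Embeddings of F as cosets in the Galois group *)

Section Embeddings.
Variables (k : fieldType) (L : splittingFieldType k) (F E : {subfield L}).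
Hypotheses (galE : galois 1 E) (sFE : (F <= E)%VS).
Local Notation G := ('Gal(E / 1%AS))%G.
Local Notation U := ('Gal(E / F))%G.

(* [gal_of E] multiplies on the right, (g * h) a = h (g a), so the embeddings of F
   are the right cosets of U and G acts on them by right translation. *)
Definition coset_emb (c : {set gal_of E}) : 'AHom(subvs_of F, L) :=
  (repr c \o linfun_ahom vsval)%AF.

Lemma coset_embE c t : coset_emb c t = repr c (vsval t).
Proof. by rewrite comp_lfunE lfunE. Qed.

(** This makes the representative chosen in [coset_emb] immaterial. *)
Lemma rcoset_galP (g h : gal_of E) :
  reflect (forall t : subvs_of F, g (vsval t) = h (vsval t))
          ((U :* g)%g == (U :* h)%g).
Proof.
have FE (t : subvs_of F) : vsval t \in E by apply: (subvP sFE); apply: subvsP.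
apply: (iffP eqP) => [eq_gh t | gh].
  have /rcosetP[u Uu ->]: (g \in U :* h)%g by rewrite -eq_gh rcoset_refl.
  by rewrite galM // (fixed_gal sFE Uu) ?subvsP.
apply/rcoset_eqP; rewrite mem_rcoset gal_kHom //; apply/kAHomP => a Fa.
have Ea := subvP sFE a Fa.
rewrite galM //; have := gh (vsproj F a); rewrite vsprojK // => ->.
by rewrite -galM // mulgV gal_id.
Qed.

Lemma coset_emb_rcoset g (t : subvs_of F) :
  coset_emb (U :* g)%g t = g (vsval t).
Proof.
by rewrite coset_embE; apply: (rcoset_galP _ _ _); rewrite rcoset_repr.
Qed.

Lemma coset_emb_inj :
  {in rcosets U G &, forall a b, coset_emb a =1 coset_emb b -> a = b}.
Proof.
move=> _ _ /rcosetsP[g _ ->] /rcosetsP[h _ ->] eq_gh.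
apply/eqP/rcoset_galP => t.
by rewrite -!coset_emb_rcoset eq_gh.
Qed.

Lemma coset_emb_surj (y : 'AHom(subvs_of F, L)) :
  exists2 c, c \in rcosets U G & coset_emb c =1 y.
Proof.
(* Composing with the projection onto F turns y into a map defined on L, which agrees on F with an
   automorphism of E because E is normal. *)
pose f := (y \o linfun (vsproj F))%VF.
have fE a : f a = y (vsproj F a) by rewrite comp_lfunE lfunE.
have f_hom : kHom 1 F f.
  rewrite k1HomE; apply/ahom_inP; split=> [a b Fa Fb|].
    rewrite !fE -rmorphM; congr (y _); apply: val_inj.
    by rewrite /= !vsprojK // rpredM.
  rewrite fE (_ : vsproj F 1 = 1) ?rmorph1 //; apply: val_inj.
  by rewrite /= vsprojK ?mem1v // algid1.
have [_ _ nE] := and3P galE.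
have s1FE : (1 <= F <= E)%VS by rewrite sub1v.
have [g Gg fg] := kHom_to_gal s1FE nE f_hom.
exists (U :* g)%g; first by apply/rcosetsP; exists g.
move=> t; rewrite coset_emb_rcoset -fg ?subvsP // fE; congr (y _).
by rewrite vsvalK.
Qed.

Lemma coset_emb_act a g : a \in rcosets U G ->
  coset_emb ('Rs a g)%act =1 g \o coset_emb a.
Proof.
case/rcosetsP=> h _ -> t; rewrite /= rcosetE -rcosetM !coset_emb_rcoset galM //.
by apply: (subvP sFE); apply: subvsP.
Qed.

End Embeddings.

(** * The regular group of a Hopf Galois structure, and the conclusion *)

Lemma hopf_galois_regular_group (k : fieldType) (L : splittingFieldType k)
    (F E : {subfield L}) :
    galois 1 E -> (F <= E)%VS -> hopf_galois (subvs_of F) ->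
  let S := rcosets 'Gal(E / F) 'Gal(E / 1%AS) in
  exists N : {group {perm {set gal_of E}}},
    [/\ [transitive N, on S | 'P]%g, #|N| = #|S|
      & (actperm 'Rs @* 'Gal(E / 1%AS) \subset 'N(N))%g].
Proof.
move=> galE sFE [H [hH [act [_ modA bij_act]]]] S.
have [w wP] := transports_exist L bij_act.
pose emb := @coset_emb k L F E.
(* The vector from a to b is the unique element of L (x) H carrying the embedding a to b; g acts on
   it through its coefficients in L. *)
pose v a b := w (emb a) (emb b).
have vP a b : transports act (v a b) (emb a) (emb b) by apply: wP.
have vU e a b : transports act e (emb a) (emb b) -> v a b = e.
  by move=> eP; apply: (transports_unique bij_act (vP a b) eP).
apply: (@translation_group _ _ _ 'Rs%act 'Gal(E / 1%AS)%G S v).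
- exact: actsRs_rcosets.
- by apply/set0Pn; exists ('Gal(E / F))%g; apply/rcosetsP; exists 1%g;
    rewrite ?rcoset1.
- move=> a b b' Sa Sb Sb' eq_v; apply: (coset_emb_inj sFE Sb Sb') => t.
  by rewrite [LHS](vP a b) [RHS](vP a b') eq_v.
- move=> a b a' Sa Sb Sa'.
  have [y' a'y'] := transports_extend modA bij_act (emb a') (vP a b).
  have [b' Sb' b'y'] := coset_emb_surj galE sFE y'.
  by exists b' => //; apply: vU => t; rewrite [LHS]b'y'.
- move=> a b c a' b' c' _ _ eq_ab eq_bc.
  have [e eP] := transports_comp modA (v a b) (v b c).
  rewrite (vU _ _ _ (eP _ _ _ (vP a b) (vP b c))).
  by apply/esym/vU/(eP _ (emb b')); [rewrite eq_ab | rewrite eq_bc]; apply: vP.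
- move=> a b _ _; have [e eP] := transports_id L modA.
  by rewrite (vU e) ?(vU e).
move=> g a b a' b' _ [Sa Sb] [Sa' Sb'] eq_v.
have act_v c d : c \in S -> d \in S ->
    v ('Rs c g)%act ('Rs d g)%act = [ffun i => g (v c d i)].
  move=> Sc Sd; apply: vU.
  by apply: transports_post (vP c d) _ _; apply: coset_emb_act.
by rewrite !act_v // eq_v.
Qed.

Theorem proposition4p12 (k : fieldType) (L : splittingFieldType k)
    (K Kt F : {subfield L}) :
  separable 1%VS K -> \dim K = 6%N ->
  galois_closure K Kt ->
  ('Gal(Kt / 1%AS) \isog 'Alt_('I_6))%g ->
  (K <= F)%VS -> (F <= Kt)%VS -> F != Kt ->
  ~ hopf_galois (subvs_of F).
Proof.
move=> _ dimK [sKE galE _] isoG sKF sFE neF hopfF.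
have oG : #|'Gal(Kt / 1%AS)%g| = 360%N.
  have := @card_Alt 'I_6; rewrite card_ord (card_isog isoG) => /(_ isT)/eqP.
  by rewrite -[(6`!)%N]/(2 * 360)%N eqn_pmul2l // => /eqP.
have simpG : simple 'Gal(Kt / 1%AS)%g.
  by rewrite (isog_simple isoG) simple_Alt5 // card_ord.
have [N [trN oN nNG]] := hopf_galois_regular_group galE sFE hopfF.
have sUG : ('Gal(Kt / F) \subset 'Gal(Kt / 1%AS))%g by rewrite galS ?sub1v.
have fixU : fixedField 'Gal(Kt / F)%g = F.
  by apply/galois_fixedField; apply: galoisS galE; rewrite sub1v.
have [] := regular_normalised_card simpG oG (transRs_rcosets _ _) trN oN nNG.
  (* One coset means F = k, which is too small to contain K. *)
  move=> /eqP; rewrite -[_ == _]/(#|_ : _|%g == 1%N) indexg_eq1 => sGU.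
  have F1 : F = 1%VS :> {vspace L}.
    rewrite -fixU -(galois_fixedField galE) /=; congr (fixedField _).
    by apply/eqP; rewrite eqEsubset sUG.
  have := dimvS sKF; rewrite dimK F1 dimv1 //.
rewrite -[#|rcosets _ _|]/(#|_ : _|%g) => oGU.
(* With 360 cosets the group of Kt over F is trivial, so its fixed field F is Kt. *)
have U1: #|'Gal(Kt / F)%g| = 1%N.
  have := Lagrange sUG; rewrite oGU oG => /(congr1 (divn^~ 360%N)).
  by rewrite mulnK.
case/negP: neF; apply/eqP/val_inj/eqP.
rewrite /= eqEsubv sFE -fixU; apply/subvP => a Ea; apply/fixedFieldP => // x.
by rewrite (card1_trivg U1) => /set1P->; rewrite gal_id.
Qed.
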